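(* Let $E, F, G$ be real Banach spaces, let $U_E \subset E$ and $U_F \subset F$ be open, and let $k \ge 1$. Let $\phi \in C^k(U_E, F)$ and $\psi \in C^k(U_F, G)$, let $x \in U_E$ and suppose $y := \phi(x) \in U_F$. Then for all $u_1,\dots,u_k\in E$, $$D(\psi\circ\phi;\, x;\, u_1,\dots,u_k) = \sum_{\pi \vdash [k]} D\bigl(\psi;\, y;\, (D(\phi;\, x;\, u_B))_{B\in\pi}\bigr),$$ where the sum runs over all unordered partitions $\pi$ of $[k] = \{1,\dots,k\}$ into non-empty blocks. (The order of the blocks is immaterial because higher derivatives are symmetric.)
   Context: Differentiability is in the Fréchet sense: $\phi: U_E \to F$ is $C^1$ if it is Fréchet differentiable at every point and its derivative is continuous as a map into the bounded linear maps with operator norm; recursively, $\phi$ is $C^k$ if it is $C^1$ and its derivative is $C^{k-1}$. $C^k(U_E,F)$ is the space of such maps. For $m \le k$, $D(\phi;x;v_1,\dots,v_m)$ denotes the $m$-th Fréchet derivative of $\phi$ at $x$ evaluated on the directions $v_1,\dots,v_m$ (the order $m$ being the number of direction arguments); it is a bounded symmetric $m$-linear form in $v_1,\dots,v_m$. The composition $\psi\circ\phi$ is defined on the open neighborhood $\phi^{-1}(U_F)$ of $x$. An unordered partition $\pi \vdash I$ of a finite set $I$ is a set $\pi = \{B_1,\dots,B_r\}$ of pairwise disjoint non-empty subsets (blocks) $B_i \subset I$ with union $I$. For a block $B \subset [k]$, $u_B := (u_b)_{b\in B}$, so $D(\phi;x;u_B)$ is the $|B|$-th derivative of $\phi$ at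 $x$ evaluated on the vectors $u_b$, $b\in B$, and $D(\psi;y;(w_B)_{B\in\pi})$ is the $|\pi|$-th derivative of $\psi$ at $y$ evaluated on the vectors $w_B$, $B \in \pi$. *)

(* Defs.v *)
From HB Require Import structures.
From mathcomp Require Import all_boot all_order all_algebra.
From mathcomp Require Import all_classical all_reals all_analysis.

Set Implicit Arguments.
Unset Strict Implicit.
Unset Printing Implicit Defensive.

Import Order.TTheory GRing.Theory Num.Theory.
Import numFieldNormedType.Exports.

Local Open Scope classical_set_scope.
Local Open Scope ring_scope.

Section BoundedLinear.
Context {R : realType} {E F : normedModType R}.
Implicit Types f g : E -> F.

Definition bounded_linear : {pred (E -> F)} :=
  mem [set f : E -> F |
        linear f /\ exists M : R, forall x, `|f x| <= M * `|x|].

Lemma bounded_linearP f :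
  reflect (linear f /\ exists M : R, forall x, `|f x| <= M * `|x|)
          (f \in bounded_linear).
Proof. by apply: (iffP idP) => [/set_mem|H]; last exact: mem_set. Qed.

Lemma bounded_linear_submod_closed : submod_closed bounded_linear.
Proof.
split.
  apply/bounded_linearP; split=> [a x y|].
    by rewrite -[0]/(cst 0) /= scaler0 addr0.
  by exists 0 => x; rewrite mul0r -[X in `|X|]/(0 : F) normr0.
move=> a f g /bounded_linearP[lf [M fM]] /bounded_linearP[lg [N gN]].
apply/bounded_linearP; split=> [b x y|].
  rewrite !fctE lf lg !scalerDr !scalerA (mulrC a b) !addrA; congr (_ + _).
  by rewrite -!addrA; congr (_ + _); rewrite addrC.
exists (`|a| * M + N) => x; rewrite !fctE (le_trans (ler_normD _ _))//.
by rewrite mulrDl lerD// normrZ -mulrA ler_wpM2l.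
Qed.

HB.instance Definition _ := GRing.isSubmodClosed.Build _ _ bounded_linear
  bounded_linear_submod_closed.

Record blin := Blin { blin_fun :> E -> F ; _ : blin_fun \in bounded_linear }.

HB.instance Definition _ := [isSub for blin_fun].
HB.instance Definition _ := [Choice of blin by <:].
HB.instance Definition _ := [SubChoice_isSubLmodule of blin by <:].

Definition opnorm (f : blin) : R :=
  sup [set `|f x| | x in [set x : E | `|x| <= 1]].

Lemma blinP (f : blin) :
  linear f /\ exists M : R, forall x, `|f x| <= M * `|x|.
Proof. exact/bounded_linearP/valP. Qed.

HB.instance Definition _ (f : blin) :=
  GRing.isLinear.Build R E F *:%R f (proj1 (blinP f)).

Lemma opnorm_has_sup (f : blin) :
  has_sup [set `|f x| | x in [set x : E | `|x| <= 1]].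
Proof.
split; first by exists `|f 0|, 0; rewrite //= normr0.
have [_ [M fM]] := blinP f; exists `|M| => _ [x /= x1 <-].
rewrite (le_trans (fM x))// (le_trans (ler_norm _))// normrM normr_id.
by rewrite ler_piMr.
Qed.

Lemma opnorm_le (f : blin) x : `|x| <= 1 -> `|f x| <= opnorm f.
Proof.
by move=> x1; apply: sup_upper_bound; [exact: opnorm_has_sup|exists x].
Qed.

Lemma opnorm_ub (f : blin) (M : R) :
  (forall x, `|x| <= 1 -> `|f x| <= M) -> opnorm f <= M.
Proof.
move=> fM; apply: ge_sup; first by case: (opnorm_has_sup f).
by move=> _ [x /= x1 <-]; exact: fM.
Qed.

Lemma opnormD (f g : blin) : opnorm (f + g) <= opnorm f + opnorm g.
Proof.
apply: opnorm_ub => x x1; rewrite (le_trans (ler_normD _ _))//.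
by rewrite lerD// opnorm_le.
Qed.

Lemma opnormZ_le (a : R) (f : blin) : opnorm (a *: f) <= `|a| * opnorm f.
Proof.
by apply: opnorm_ub => x x1; rewrite normrZ ler_wpM2l// opnorm_le.
Qed.

Lemma opnormZ (a : R) (f : blin) : opnorm (a *: f) = `|a| * opnorm f.
Proof.
apply/le_anti; rewrite opnormZ_le/=.
have [->|a0] := eqVneq a 0.
  by rewrite normr0 mul0r (le_trans _ (opnorm_le _ (x := 0) _))// normr0.
rewrite -ler_pdivlMl ?normr_gt0// -normfV (le_trans _ (opnormZ_le _ _))//.
by rewrite scalerA mulVf// scale1r.
Qed.

Lemma opnorm0_eq0 (f : blin) : opnorm f = 0 -> f = 0.
Proof.
move=> f0; apply/val_inj/funext => x /=.
have [->|x0] := eqVneq x 0; first by rewrite linear0.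
have : `|f (`|x|^-1 *: x)| <= 0.
  by rewrite -f0 opnorm_le// normrZ normfV normr_id mulVf ?normr_eq0.
by rewrite linearZ/= normr_le0 scaler_eq0 invr_eq0 normr_eq0 (negbTE x0) => /eqP.
Qed.

HB.instance Definition _ := @Lmodule_isNormed.Build R blin opnorm
  opnormD opnormZ opnorm0_eq0.

End BoundedLinear.

Arguments blin {R} E F.

Notation "''L' ( E , F )" := (blin E F) (format "''L' ( E ,  F )").

Section HigherDerivatives.
Context {R : realType} {E : normedModType R}.

(* The value of [insubd] is the differential when it is bounded, which is
   always the case at a point of differentiability, and 0 otherwise. *)
Definition fderiv {F : normedModType R} (f : E -> F) (x : E) : 'L(E, F) :=
  insubd (0 : 'L(E, F)) ('d f x : E -> F).

(* Maps defined on an open set are represented by total functions, whose values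
   off that set play no role: [differentiable], ['d], [{for x, continuous _}]
   only depend on the germ at the point. *)
Definition C1 {F : normedModType R} (U : set E) (f : E -> F) : Prop :=
  (forall x, U x -> differentiable f x) /\
  (forall x, U x -> {for x, continuous (fderiv f)}).

Fixpoint Ck (k : nat) {F : normedModType R} (U : set E) (f : E -> F) : Prop :=
  if k is k'.+1 then C1 U f /\ Ck k' U (fderiv f)
  else forall x, U x -> {for x, continuous f}.

(* [Dn f x [:: v1; ...; vm]] is the m-th derivative, seen as an element of
   L(E, L(E, ... L(E, F))), of which v1 is the last argument to be supplied. *)
Fixpoint Dn {F : normedModType R} (f : E -> F) (x : E) (vs : seq E) : F :=
  if vs is v :: vs' then Dn (fderiv f) x vs' v else f x.

End HigherDerivatives.

(* Blocks and partitions are listed in the order of the canonical enumerations,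
   the derivatives being symmetric in their direction arguments. *)
Definition Dblock {R : realType} {E F : normedModType R} (f : E -> F) (x : E)
    {k : nat} (u : 'I_k -> E) (B : {set 'I_k}) : F :=
  Dn f x [seq u b | b <- enum B].

(* Main.v *)
Require Import Defs.
From HB Require Import structures.
From mathcomp Require Import all_boot all_order all_algebra.
From mathcomp Require Import all_classical all_reals all_analysis.
From mathcomp Require Import ring.
Import Order.TTheory GRing.Theory Num.Theory.
Import numFieldNormedType.Exports.
Local Open Scope classical_set_scope.
Local Open Scope ring_scope.

Set Implicit Arguments.
Unset Strict Implicit.
Unset Printing Implicit Defensive.

(** Two facts are proved together: the chain rule iterates, so a composite of
C^k maps is C^k, and its k-th derivative is a sum over set partitions.

Regularity.  The derivative of [psi \o phi] at [z] is the composite of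
[fderiv psi (phi z)] and [fderiv phi z], i.e. a bounded bilinear expression in
two maps that are C^(k-1): the first by induction on [k] (for all target spaces
at once), the second by hypothesis.  So the class C^k only has to be shown stable
under bounded bilinear operations ([Ck_bilinear]), which follows by induction
from the product rule, because the two terms of the product rule are themselves
bounded bilinear expressions with values in a space of bounded linear maps.

The formula.  It is shown for [Dblock (psi \o phi) z u A], #|A| <= k, at every
point [z] of the open set where the composite is defined, by induction on [#|A|]
([Dblock_comp]).  Let [i] be the largest element of [A] and [A' = A :\ i].  The
derivative in the direction [u i] of the term attached to a partition [P] of [A']
is, by the chain rule and the multilinearity of the derivatives of [psi]
([is_diff_Dn_comp]), a sum of #|P| + 1 terms: either [psi] is differentiated once
more, in the direction [fderiv phi z (u i)], which adds the block {i} to [P], or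
one factor [Dblock phi z u B] is differentiated, which adds [i] to the block [B].
Every partition of [A] arises exactly once in this way ([big_partitionU1]).

The order of the arguments.  Taking for [i] the largest element makes the
enumeration of each block grow at its end, where a new derivative adds its
direction.  The enumeration of the blocks themselves is not controlled, and there
the symmetry of the higher derivatives of [psi] is needed ([Dn_perm]).  It comes
from the symmetry of second derivatives ([fderiv2_sym]), which in turn rests on
the mean value inequality for curves in a normed space. *)

(** * Bounded linear maps and Fréchet derivatives *)

Section Blin.
Context {R : realType} {E F : normedModType R}.

(** Totalized like [fderiv], so that bounded linear maps can be built from
functions before, and independently of, the proof that they are bounded. *)
Definition mkblin (f : E -> F) : 'L(E, F) := insubd (0 : 'L(E, F)) f.

Lemma mkblinE (f : E -> F) (M : R) :
  linear f -> (forall x, `|f x| <= M * `|x|) -> mkblin f = f :> (E -> F).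
Proof.
move=> lf fM; apply: (@insubdK _ _ 'L(E, F)).
by apply/bounded_linearP; split=> //; exists M.
Qed.

Lemma blin_ext (f g : 'L(E, F)) : f =1 g -> f = g.
Proof. by move=> fg; apply/val_inj/funext. Qed.

Lemma ler_norm_blin (f : 'L(E, F)) (x : E) : `|f x| <= `|f| * `|x|.
Proof.
have [->|x0] := eqVneq x 0; first by rewrite linear0 !normr0 mulr0.
rewrite -ler_pdivrMr ?normr_gt0// mulrC -[`|x|^-1]ger0_norm// -normrZ.
by rewrite -linearZ opnorm_le// normrZ normfV normr_id mulVf ?normr_eq0.
Qed.

Lemma norm_blin_le (f : 'L(E, F)) (M : R) : 0 <= M ->
  (forall x, `|f x| <= M * `|x|) -> `|f| <= M.
Proof.
move=> M0 fM; apply: opnorm_ub => x x1.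
by rewrite (le_trans (fM x))// ler_piMr.
Qed.

Lemma blin_continuous (f : 'L(E, F)) : continuous f.
Proof.
apply/linear_bounded_continuous/linear_boundedP.
exists `|f|; split=> [|r fr x]; first exact: num_real.
by rewrite (le_trans (ler_norm_blin f x))// ler_wpM2r// ltW.
Qed.

Lemma fderivE (f : E -> F) (x : E) :
  differentiable f x -> fderiv f x = 'd f x :> (E -> F).
Proof.
move=> df; have [M _ dM] := linear_lipschitz (diff_continuous df).
by apply: (@mkblinE _ M) => //; exact: linearP.
Qed.

Lemma is_diff_fderiv (f : E -> F) (x : E) :
  differentiable f x -> is_diff x f (fderiv f x).
Proof. by move=> df; apply: DiffDef => //; rewrite fderivE. Qed.

Lemma fderiv_val (f df : E -> F) (x : E) :
  is_diff x f df -> fderiv f x = df :> (E -> F).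
Proof. by move=> [df_ <-]; rewrite fderivE. Qed.

Lemma is_diff_blin (f : 'L(E, F)) x : is_diff x f f.
Proof.
by apply: DiffDef; [exact/linear_differentiable/blin_continuous|
  exact/diff_lin/blin_continuous].
Qed.

(** The epsilon form of differentiability: unlike the Landau notation, it can be
transported along an equality of germs and evaluated at explicit increments. *)
Lemma is_diffP (f : E -> F) (x : E) (L : 'L(E, F)) :
  is_diff x f L <->
  (forall e, 0 < e -> \forall h \near 0, `|f (h + x) - f x - L h| <= e * `|h|).
Proof.
split=> [[df dfL] e e0|H].
  have /eqaddoP/(_ _ e0) := diff_locally df; rewrite dfL.
  by apply: filterS => h; rewrite /= !fctE opprD addrA.
have fL : f \o shift x = cst (f x) + (L : E -> F) +o_ 0 id.
  apply/eqaddoP => e /H; apply: filterS => h.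
  by rewrite /= !fctE opprD addrA.
have cL := @blin_continuous L.
have dL := diff_unique cL fL.
by apply: DiffDef => //; apply/diff_locallyP; rewrite dL.
Qed.

Lemma is_diff_near (f g : E -> F) (x : E) (L : 'L(E, F)) :
  (\forall y \near x, f y = g y) -> is_diff x f L -> is_diff x g L.
Proof.
move=> fg /is_diffP H; apply/is_diffP => e /H.
have gx : f x = g x by exact: nbhs_singleton fg.
move/nbhs0P: fg; apply: filterS2 => h fgh.
by rewrite addrC in fgh; rewrite fgh gx.
Qed.

End Blin.

(** * Maps of class C^k *)

Section CkTheory.
Context {R : realType} {E : normedModType R}.
Implicit Types (U V : set E) (F : normedModType R).

Lemma Ck_continuous k F U (f : E -> F) :
  Ck k U f -> forall x, U x -> {for x, continuous f}.
Proof.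
by case: k => [//|k] [[df _] _] x Ux; exact/differentiable_continuous/df.
Qed.

(** The continuity of the derivative in [C1] is implied by the second clause of
[Ck], since each class C^k is contained in the continuous maps. *)
Lemma CkSP k F U (f : E -> F) :
  Ck k.+1 U f <-> (forall x, U x -> differentiable f x) /\ Ck k U (fderiv f).
Proof.
split=> [[[df _] Cf]|[df Cf]] //; split=> //; split=> //.
exact: Ck_continuous Cf.
Qed.

Lemma Ck_pred k F U (f : E -> F) : Ck k.+1 U f -> Ck k U f.
Proof.
elim: k F f => [|k IH] F f /CkSP[df Cf]; last by apply/CkSP; split=> //; exact: IH.
by move=> x /df; exact: differentiable_continuous.
Qed.

Lemma Ck_le m k F U (f : E -> F) : (m <= k)%N -> Ck k U f -> Ck m U f.
Proof.
move=> /subnK <-; elim: (k - m)%N => [//|n IH].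
by rewrite addSn => /Ck_pred.
Qed.

Lemma CkW k F U V (f : E -> F) : V `<=` U -> Ck k U f -> Ck k V f.
Proof.
move=> VU; elim: k F f => [|k IH] F f; first by move=> Cf x /VU; exact: Cf.
by move=> /CkSP[df Cf]; apply/CkSP; split=> [x /VU/df//|]; exact: IH.
Qed.

Lemma eq_fderiv F (f g : E -> F) (x : E) : differentiable f x ->
  (\forall y \near x, f y = g y) -> differentiable g x /\ fderiv g x = fderiv f x.
Proof.
move=> /is_diff_fderiv df fg; have dg := is_diff_near fg df.
split; first by case: dg.
by apply: blin_ext => v; exact: (congr1 (@^~ v) (fderiv_val dg)).
Qed.

Lemma eq_Ck k F U (f g : E -> F) : open U -> (forall x, U x -> f x = g x) ->
  Ck k U f -> Ck k U g.
Proof.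
move=> oU; have nearU x (P : E -> Prop) :
    (forall y, U y -> P y) -> U x -> \forall y \near x, P y.
  by move=> UP Ux; near=> y; apply: UP; near: y; exact: open_nbhs_nbhs.
elim: k F f g => [|k IH] F f g fg Cf.
  move=> x Ux; have := Cf x Ux; rewrite /prop_for /continuous_at (fg _ Ux).
  by apply: cvg_trans; apply: near_eq_cvg; exact: nearU fg Ux.
move/CkSP: Cf => [df Cf]; apply/CkSP; split.
  by move=> x Ux; have [] := eq_fderiv (df x Ux) (nearU _ _ fg Ux).
apply: IH Cf => x Ux.
by have [_ ->] := eq_fderiv (df x Ux) (nearU _ _ fg Ux).
Unshelve. all: by end_near. Qed.

(** The usual way to climb one class: it is enough to exhibit a map that is C^k
and agrees with the derivative at the points of [U]. *)
Lemma CkS_is_diff k F U (f : E -> F) (df : E -> 'L(E, F)) : open U ->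
  (forall x, U x -> is_diff x f (df x)) -> Ck k U df -> Ck k.+1 U f.
Proof.
move=> oU fdf Cdf; apply/CkSP; split.
  by move=> x /fdf[].
apply: eq_Ck Cdf => // x Ux.
by apply: blin_ext => v; rewrite (fderiv_val (fdf x Ux)).
Qed.

Lemma CkD k F U (f g : E -> F) : open U ->
  Ck k U f -> Ck k U g -> Ck k U (fun x => f x + g x).
Proof.
move=> oU; elim: k F f g => [|k IH] F f g.
  by move=> Cf Cg x Ux; apply: continuousD; [exact: Cf|exact: Cg].
move=> /CkSP[df Cf] /CkSP[dg Cg].
apply: CkS_is_diff (IH _ _ _ Cf Cg) => // x Ux.
by apply: is_diffD; apply: is_diff_fderiv; [exact: df|exact: dg].
Qed.

End CkTheory.

(** * Bounded bilinear operations and composition *)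

Section BoundedBilinear.
Context {R : realType}.
Implicit Types A B C E F G : normedModType R.

Record bounded_bilinear A B C (b : A -> B -> C) : Prop := BoundedBilinear {
  bbil_linear_r : forall u, linear (b u);
  bbil_linear_l : forall v, linear (b ^~ v);
  bbil_bound : exists2 M, 0 <= M & forall u v, `|b u v| <= M * `|u| * `|v| }.

Lemma bounded_bilinear_flip A B C (b : A -> B -> C) :
  bounded_bilinear b -> bounded_bilinear (fun v u => b u v).
Proof.
case=> br bl [M M0 bM]; split=> //; exists M => // v u.
by rewrite mulrAC.
Qed.

(** The two terms of the product rule for [b (f z) (g z)]: the derivative of [g]
is composed with [b (f z)], that of [f] with [b ^~ (g z)].  For [b] the evaluation
of linear maps, [comp_r] is the composition of operators. *)
Definition comp_r A B C E (b : A -> B -> C) (u : A) (l : 'L(E, B)) : 'L(E, C) :=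
  mkblin (fun h => b u (l h)).

Definition comp_l A B C E (b : A -> B -> C) (l : 'L(E, A)) (v : B) : 'L(E, C) :=
  mkblin (fun h => b (l h) v).

Lemma comp_rE A B C E (b : A -> B -> C) (u : A) (l : 'L(E, B)) :
  bounded_bilinear b -> comp_r b u l = (fun h => b u (l h)) :> (E -> C).
Proof.
case=> br _ [M M0 bM]; apply: (@mkblinE _ _ _ _ (M * `|u| * `|l|)).
  by move=> a h h'; rewrite linearP br.
move=> h; rewrite (le_trans (bM _ _))// -[leRHS]mulrA ler_wpM2l ?mulr_ge0//.
exact: ler_norm_blin.
Qed.

Lemma comp_lE A B C E (b : A -> B -> C) (l : 'L(E, A)) (v : B) :
  bounded_bilinear b -> comp_l b l v = (fun h => b (l h) v) :> (E -> C).
Proof. by move=> /bounded_bilinear_flip bb; exact: (comp_rE v l bb). Qed.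

Lemma bounded_bilinear_comp_r A B C E (b : A -> B -> C) :
  bounded_bilinear b -> bounded_bilinear (@comp_r A B C E b).
Proof.
move=> bb; have rE u (l : 'L(E, B)) h : comp_r b u l h = b u (l h) by rewrite comp_rE.
case: bb => br bl [M M0 bM]; split.
- move=> u a l l'; apply: blin_ext => h.
  by rewrite -[RHS]/(a *: comp_r b u l h + comp_r b u l' h) !rE -br.
- move=> l a u u'; apply: blin_ext => h.
  by rewrite -[RHS]/(a *: comp_r b u l h + comp_r b u' l h) !rE -bl.
- exists M => // u l; apply: norm_blin_le; first by rewrite !mulr_ge0.
  move=> h; rewrite rE (le_trans (bM _ _))// -[leRHS]mulrA.
  by rewrite ler_wpM2l ?mulr_ge0//; exact: ler_norm_blin.
Qed.

Lemma bounded_bilinear_comp_l A B C E (b : A -> B -> C) :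
  bounded_bilinear b -> bounded_bilinear (@comp_l A B C E b).
Proof.
move=> /bounded_bilinear_flip bb.
exact: bounded_bilinear_flip (bounded_bilinear_comp_r E bb).
Qed.

Lemma bounded_bilinear_eval E F :
  bounded_bilinear (fun (l : 'L(E, F)) (v : E) => l v).
Proof.
split=> [l|v|]; first exact: linearP.
  by move=> a l l'.
by exists 1 => // l v; rewrite mul1r ler_norm_blin.
Qed.

(** From the splitting b(u,v) - b(u',v') = b(u - u', v) + b(u', v - v'): close to
(u,v) the norm of u' is at most |u| + 1, so the difference is at most
M (|u| + |v| + 1) times the distance. *)
Lemma bounded_bilinear_continuous A B C (b : A -> B -> C) :
  bounded_bilinear b -> continuous (fun p => b p.1 p.2).
Proof.
case=> br bl [M M0 bM] [u v]; apply/cvgrPdist_le => e e0 /=.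
(* the summand 1 only makes [K] invertible *)
pose K := M * (`|u| + `|v| + 1) + 1.
have K0 : 0 < K by rewrite ltr_wpDl// mulr_ge0// !addr_ge0.
near=> q.
have [q1 qe] : `|(u, v) - q| <= 1 /\ `|(u, v) - q| <= e / K.
  by split; near: q; apply: cvgr_dist_le; rewrite ?divr_gt0//; exact: cvg_id.
set d := `|(u, v) - q| in q1 qe.
have d1 : `|u - q.1| <= d by rewrite /d prod_normE le_max lexx.
have d2 : `|v - q.2| <= d by rewrite /d prod_normE le_max lexx orbT.
have d0 : 0 <= d by rewrite /d.
have -> : b u v - b q.1 q.2 = b (u - q.1) v + b q.1 (v - q.2).
  have -> : b (u - q.1) v = b u v - b q.1 v.
    by rewrite addrC -scaleN1r bl scaleN1r addrC.
  have -> : b q.1 (v - q.2) = b q.1 v - b q.1 q.2.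
    by rewrite addrC -scaleN1r br scaleN1r addrC.
  by rewrite addrA subrK.
have q1u : `|q.1| <= `|u| + 1.
  rewrite -[q.1](subKr u) (le_trans (ler_normB _ _))// lerD2l.
  exact: le_trans d1 q1.
rewrite (le_trans (ler_normD _ _))//.
apply: (@le_trans _ _ (M * d * `|v| + M * (`|u| + 1) * d)).
  apply: lerD; rewrite (le_trans (bM _ _))//.
    by rewrite ler_wpM2r// ler_wpM2l.
  by rewrite ler_pM// ?mulr_ge0// ler_wpM2l.
rewrite (_ : _ + _ = M * (`|u| + `|v| + 1) * d); last by ring.
rewrite ler_pdivlMr// mulrC in qe; apply: le_trans qe.
by rewrite ler_wpM2r// /K lerDl.
Unshelve. all: by end_near. Qed.

Lemma is_diff_bilinear E A B C (b : A -> B -> C) (f df : E -> A) (g dg : E -> B) x :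
  bounded_bilinear b -> is_diff x f df -> is_diff x g dg ->
  is_diff x (fun z => b (f z) (g z)) (fun h => b (f x) (dg h) + b (df h) (g x)).
Proof.
move=> bb dfx dgx; have cb := bounded_bilinear_continuous bb.
case: bb => br bl _.
have bilb : bilinear_for (GRing.Scale.Law.clone _ _ *:%R _)
    (GRing.Scale.Law.clone _ _ *:%R _) b by split.
pose bM := bilinear_isBilinear.Build _ _ _ _ _ _ b bilb.
pose B' : {bilinear A -> B -> C} := HB.pack b bM.
have db : is_diff (f x, g x) (fun q => B' q.1 q.2)
    (fun q => B' (f x) q.2 + B' q.1 (g x)).
  by apply: DiffDef; [exact: differentiable_bilin|rewrite diff_bilin].
have dp : is_diff x (fun z => (f z, g z)) (fun h => (df h, dg h)) by exact: is_diff_pair.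
exact: (@is_diff_comp _ _ _ _ _ _ _ _ _ dp db).
Qed.

(** By induction on [k], for all bilinear operations at once: the derivative is
[comp_r b (f z) (fderiv g z) + comp_l b (fderiv f z) (g z)], and [comp_r b] and
[comp_l b] are bounded bilinear with arguments of class C^k. *)
Lemma Ck_bilinear k E (U : set E) A B C (b : A -> B -> C) (f : E -> A) (g : E -> B) :
  open U -> bounded_bilinear b -> Ck k U f -> Ck k U g ->
  Ck k U (fun z => b (f z) (g z)).
Proof.
move=> oU; elim: k A B C b f g => [|k IH] A B C b f g bb.
  move=> Cf Cg x Ux.
  have := bounded_bilinear_continuous bb.
  move=> /(_ (f x, g x)) cb.
  apply: (@continuous_comp _ _ _ (fun z => (f z, g z)) (fun p => b p.1 p.2)) => //.
  by apply: cvg_pair; [exact: Cf|exact: Cg].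
move=> CSf CSg; have := CSf; have := CSg.
move=> /CkSP[dg Cdg] /CkSP[df Cdf].
pose D z := comp_r b (f z) (fderiv g z) + comp_l b (fderiv f z) (g z).
apply: (@CkS_is_diff _ _ k C U (fun z => b (f z) (g z)) D oU) => [x Ux|].
  have -> : blin_fun (D x) = (fun h => b (f x) (fderiv g x h) + b (fderiv f x h) (g x)).
    apply: funext => h; rewrite -[LHS]/(comp_r b (f x) (fderiv g x) h +
      comp_l b (fderiv f x) (g x) h).
    by rewrite comp_rE// comp_lE.
  by apply: is_diff_bilinear => //; apply: is_diff_fderiv; [exact: df|exact: dg].
apply: CkD => //; apply: IH.
- exact: bounded_bilinear_comp_r.
- exact: Ck_pred CSf.
- exact: Cdg.
- exact: bounded_bilinear_comp_l.
- exact: Cdf.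
- exact: Ck_pred CSg.
Qed.

(** The chain rule, with the derivative written as a bounded bilinear operation
so that [Ck_bilinear] applies to it. *)
Lemma is_diff_fderiv_comp E F G (f : E -> F) (g : F -> G) x :
  differentiable f x -> differentiable g (f x) ->
  is_diff x (g \o f) (comp_r (fun (l : 'L(F, G)) v => l v) (fderiv g (f x)) (fderiv f x)).
Proof.
move=> df dg; rewrite comp_rE; last exact: bounded_bilinear_eval.
by apply: is_diff_comp; exact: is_diff_fderiv.
Qed.

Lemma Ck_comp k E F G (U : set E) (V : set F) (f : E -> F) (g : F -> G) :
  open U -> (forall x, U x -> V (f x)) -> Ck k U f -> Ck k V g -> Ck k U (g \o f).
Proof.
move=> oU UV; elim: k G g => [|k IH] G g.
  by move=> Cf Cg x Ux; apply: continuous_comp; [exact: Cf|exact/Cg/UV].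
move=> CSf /CkSP[dg Cg]; have /CkSP[df Cf] := CSf.
apply: (@CkS_is_diff _ _ _ _ _ _ (fun x =>
  comp_r (fun (l : 'L(F, G)) v => l v) (fderiv g (f x)) (fderiv f x))) => //.
  by move=> x Ux; apply: is_diff_fderiv_comp; [exact: df|exact/dg/UV].
apply: Ck_bilinear => //; first exact/bounded_bilinear_comp_r/bounded_bilinear_eval.
apply: IH Cg; exact: Ck_pred.
Qed.

End BoundedBilinear.

(** * Mean value inequality and symmetry of second derivatives *)

Lemma subrBAC (V : zmodType) (a b c d : V) : a - b - (c - d) = a - c - (b - d).
Proof. by rewrite !opprB !addrA [LHS]addrAC [RHS]addrAC (addrAC a). Qed.

Section Schwarz.
Context {R : realType}.
Implicit Types E F : normedModType R.

(** The values are vectors, so there is no mean value equality to use.  For each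
e > 0, let [c] be the supremum of the times [t] at which the growth bound
|g t - g 0| <= (M + e) t holds.  Differentiability at [c] bounds the slopes of [g]
near [c] by M + e.  On the left of [c] this shows that [c] satisfies the growth
bound; on the right, that [c] could be increased if it were less than 1. *)
Lemma mean_value_inequality F (g : R -> F) (dg : R -> R -> F) (M : R) :
  (forall t : R, 0 <= t <= 1 -> is_diff t g (dg t) /\ `|dg t 1| <= M) ->
  `|g 1 - g 0| <= M.
Proof.
move=> gM; apply/ler_addgt0Pr => e e0.
have slope (t : R) : 0 <= t <= 1 -> exists2 d : R, 0 < d &
    forall s, `|s - t| < d -> `|g s - g t| <= (M + e) * `|s - t|.
  move=> /gM[dgt dgM].
  have gd : differentiable g t by case: dgt.
  have gE : fderiv g t 1 = dg t 1 by rewrite (fderiv_val dgt).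
  have /is_diffP/(_ _ e0)/nbhs_norm0P[d /= d0 H] := is_diff_fderiv gd.
  exists d => // s /H /=; rewrite subrK => {}H.
  rewrite -(subrK (fderiv g t (s - t)) (g s - g t)).
  rewrite (le_trans (ler_normD _ _))// addrC mulrDl lerD//.
  have -> : fderiv g t (s - t) = (s - t) *: dg t 1.
    by rewrite -gE -linearZ /= -[_ *: 1]/(_ * 1) mulr1.
  by rewrite normrZ mulrC ler_wpM2r.
pose S := [set t : R | 0 <= t <= 1 /\ `|g t - g 0| <= (M + e) * t].
have S0 : S 0 by split; rewrite ?lexx ?ler01// subrr normr0 mulr0.
have supS : has_sup S by split; [exists 0|exists 1 => t [/andP[]]].
set c := sup S.
have c01 : 0 <= c <= 1.
  apply/andP; split; first exact: sup_upper_bound.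
  by apply: ge_sup; [exists 0|move=> t [/andP[]]].
have [d d0 cd] := slope c c01.
have Sc : S c.
  split=> //; have [s Ss cs] := sup_adherent d0 supS.
  have sc : s <= c by exact: sup_upper_bound.
  have /cd : `|s - c| < d by rewrite ler0_norm ?subr_le0// opprB ltrBlDl -ltrBlDr.
  rewrite distrC [`|s - c|]ler0_norm ?subr_le0// opprB => gcs.
  rewrite -(subrK (g s) (g c)) -addrA (le_trans (ler_normD _ _))//.
  rewrite (le_trans (lerD gcs (proj2 Ss)))//.
  by rewrite -mulrDr subrK.
have [c1|c1] := ltP c 1; last first.
  have c_eq : c = 1 by apply/le_anti; rewrite c1 andbT; case/andP: c01.
  by have [_] := Sc; rewrite c_eq mulr1.
pose t := Num.min 1 (c + d / 2).
have ct : c < t by rewrite lt_min c1 ltrDl divr_gt0.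
suff /(sup_upper_bound supS) : S t by rewrite leNgt ct.
split.
  rewrite (le_trans (proj1 (andP c01)) (ltW ct))/=.
  by rewrite ge_min lexx.
have /cd : `|t - c| < d.
  rewrite ger0_norm ?subr_ge0 ?(ltW ct)// ltrBlDl.
  by rewrite gt_min ltrD2l ltr_pdivrMr// ltr_pMr// ltr1n orbT.
rewrite [`|t - c|]ger0_norm ?subr_ge0 ?(ltW ct)// => gtc.
rewrite -(subrK (g c) (g t)) -addrA (le_trans (ler_normD _ _))//.
rewrite (le_trans (lerD gtc (proj2 Sc)))//.
by rewrite -mulrDr subrK.
Qed.

Lemma is_diff_line E F (f : E -> F) (a b : E) (t : R) :
  differentiable f (a + t *: b) ->
  is_diff t (fun s : R => f (a + s *: b)) (fun s => s *: fderiv f (a + t *: b) b).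
Proof.
move=> df.
have dl : is_diff t (fun s : R => a + s *: b) (fun s => s *: b).
  have := is_diffD (is_diff_cst a t) (is_diff_scalel t b).
  by rewrite add0r.
have := is_diff_comp dl (is_diff_fderiv df).
by congr is_diff_def; apply: funext => s /=; rewrite linearZ.
Qed.

(** The second difference is g(1) - g(0) for the curve
g(t) = f(x + hv + thw) - f(x + thw).  Its velocity is the difference of the
derivatives of [f] at two points at distance O(h) from [x], applied to hw.  By
differentiability of [fderiv f] at [x] it equals h^2 D v w up to o(h^2),
uniformly in [t], and the mean value inequality concludes. *)
Lemma second_difference E F (f : E -> F) (x v w : E) (e : R) :
  0 < e -> (\forall z \near x, differentiable f z) ->
  differentiable (fderiv f) x ->
  \forall h \near (0 : R), `|(f (x + h *: v + h *: w) - f (x + h *: w)) -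
    (f (x + h *: v) - f x) - h ^+ 2 *: fderiv (fderiv f) x v w| <= e * h ^+ 2.
Proof.
move=> e0 df ddf; set D := fderiv (fderiv f) x.
pose N := `|v| + `|w| + 1.
have N0 : 0 < N by rewrite ltr_wpDl// addr_ge0.
(* each of the two first order remainders is at most e' |h| N, and it is applied
   to a vector of norm at most |h| N *)
pose e' := e / (N * N *+ 2).
have e'0 : 0 < e' by rewrite divr_gt0// pmulrn_lgt0// mulr_gt0.
have /is_diffP/(_ _ e'0) dd := is_diff_fderiv ddf.
have /nbhs_norm0P[r /= r0 Hr] : \forall k \near (0 : E),
    differentiable f (x + k) /\
    `|fderiv f (k + x) - fderiv f x - D k| <= e' * `|k|.
  by move/nbhs0P: df => df; apply: filterS2 df dd => k.
near=> h.
have hN : `|h| * N < r.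
  rewrite -ltr_pdivlMr//; near: h.
  exact: (@nbhs0_lt R R _ (divr_gt0 r0 N0)).
pose g (t : R) := f ((x + h *: v) + t *: (h *: w)) - f (x + t *: (h *: w))
  - t *: (h ^+ 2 *: D v w).
have small (s t : R) : 0 <= s <= 1 -> 0 <= t <= 1 ->
    `|s *: (h *: v) + t *: (h *: w)| <= `|h| * N.
  move=> /andP[s0 s1] /andP[t0 t1]; rewrite (le_trans (ler_normD _ _))//.
  rewrite !normrZ (ger0_norm s0) (ger0_norm t0) /N !mulrDr mulr1 ler_wpDr// lerD//.
    by rewrite ler_piMl// mulr_ge0.
  by rewrite ler_piMl// mulr_ge0.
have Hst (s t : R) : 0 <= s <= 1 -> 0 <= t <= 1 ->
    differentiable f (x + s *: (h *: v) + t *: (h *: w)) /\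
    `|fderiv f (x + s *: (h *: v) + t *: (h *: w)) - fderiv f x
       - D (s *: (h *: v) + t *: (h *: w))| <= e' * (`|h| * N).
  move=> s01 t01; have st := small s t s01 t01.
  have [dfk ddk] := Hr _ (le_lt_trans st hN).
  rewrite -addrA; split=> //; rewrite [x + _]addrC (le_trans ddk)//.
  by rewrite ler_wpM2l// ltW.
suff : `|g 1 - g 0| <= e * h ^+ 2.
  by rewrite /g !scale0r !scale1r !addr0 subr0 addrAC.
apply: (@mean_value_inequality _ _ (fun t s =>
  s *: (fderiv f ((x + h *: v) + t *: (h *: w)) (h *: w) -
  fderiv f (x + t *: (h *: w)) (h *: w) - h ^+ 2 *: D v w))) => t t01.
have h11 : 0 <= (1 : R) <= 1 by rewrite ler01 lexx.
have h00 : 0 <= (0 : R) <= 1 by rewrite ler01 lexx.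
have [] := Hst 1 t h11 t01; rewrite scale1r => d1 H1.
have [] := Hst 0 t h00 t01; rewrite scale0r addr0 add0r => d2 H2.
split.
  have := is_diffB (is_diffB (is_diff_line d1) (is_diff_line d2))
    (is_diff_scalel t (h ^+ 2 *: D v w)).
  by congr is_diff_def; apply: funext => s /=; rewrite !scalerBr.
rewrite scale1r.
set z1 := x + h *: v + _ in d1 H1 *; set z2 := x + _ in d2 H2 *.
have -> : fderiv f z1 (h *: w) - fderiv f z2 (h *: w) - h ^+ 2 *: D v w =
  (fderiv f z1 - fderiv f x - D (h *: v + t *: (h *: w))) (h *: w) -
  (fderiv f z2 - fderiv f x - D (t *: (h *: w))) (h *: w).
  have evB (l1 l2 l3 : 'L(E, F)) u : (l1 - l2 - l3) u = l1 u - l2 u - l3 u by [].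
  rewrite !evB linearD -[X in _ = _ - X - _]/(D (h *: v) (h *: w) + D (t *: (h *: w)) (h *: w)).
  have -> : D (h *: v) (h *: w) = h ^+ 2 *: D v w.
    by rewrite linearZ [D (h *: v)]linearZ expr2 -scalerA.
  by rewrite [RHS]subrBAC addrK opprB addrA subrK.
rewrite (le_trans (ler_normB _ _))//.
rewrite (le_trans (lerD (ler_norm_blin _ _) (ler_norm_blin _ _)))//.
rewrite -mulrDl normrZ.
apply: (@le_trans _ _ ((e' * (`|h| * N) + e' * (`|h| * N)) * (`|h| * N))).
  rewrite ler_pM ?addr_ge0 ?mulr_ge0 ?lerD//.
  by rewrite ler_wpM2l// /N addrAC lerDr// addr_ge0.
rewrite -[h ^+ 2]real_normK ?num_real// /e'.
by rewrite le_eqVlt; apply/orP; left; apply/eqP; field; rewrite gt_eqF.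
Unshelve. all: by end_near. Qed.

(** The second difference is symmetric in [v] and [w], so D v w and D w v, its
two limits after division by h^2, agree. *)
Lemma fderiv2_sym E F (f : E -> F) (x v w : E) :
  (\forall z \near x, differentiable f z) -> differentiable (fderiv f) x ->
  fderiv (fderiv f) x v w = fderiv (fderiv f) x w v.
Proof.
move=> df ddf; set D := fderiv (fderiv f) x.
apply/eqP; rewrite -subr_eq0 -normr_le0; apply/ler_addgt0Pr => e e0.
rewrite add0r.
have e2 : 0 < e / 2 by rewrite divr_gt0.
near (0 : R)^' => h.
have h0 : h != 0 by near: h; exact: nbhs_dnbhs_neq.
have h2 : 0 < h ^+ 2 by rewrite exprn_even_gt0.
have Hv : `|(f (x + h *: v + h *: w) - f (x + h *: w)) -
    (f (x + h *: v) - f x) - h ^+ 2 *: D v w| <= e / 2 * h ^+ 2.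
  by near: h; apply: nbhs_dnbhs; exact: second_difference.
have Hw : `|(f (x + h *: w + h *: v) - f (x + h *: v)) -
    (f (x + h *: w) - f x) - h ^+ 2 *: D w v| <= e / 2 * h ^+ 2.
  by near: h; apply: nbhs_dnbhs; exact: second_difference.
rewrite -(ler_pM2r h2) -[X in _ * X]ger0_norm ?(ltW h2)// mulrC -normrZ.
set a := (X in `|X - _|) in Hv; set b := (X in `|X - _|) in Hw.
have ab : a = b.
  by rewrite /a /b subrBAC [x + _ + _]addrAC.
have -> : h ^+ 2 *: (D v w - D w v) = (b - h ^+ 2 *: D w v) - (a - h ^+ 2 *: D v w).
  by rewrite ab scalerBr opprB [RHS]addrC addrA subrK.
rewrite (le_trans (ler_normB _ _))// (le_trans (lerD Hw Hv))//.
by rewrite -mulrDl -splitr.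
Unshelve. all: by end_near. Qed.

End Schwarz.

(** * Iterated derivatives *)

Section IteratedDerivatives.
Context {R : realType} {E : normedModType R}.
Implicit Types (U : set E) (F G : normedModType R).

Lemma eq_Dn k F U (f g : E -> F) (x : E) (s : seq E) : open U ->
  (forall z, U z -> f z = g z) -> Ck k U f -> (size s <= k)%N -> U x ->
  Dn f x s = Dn g x s.
Proof.
move=> oU; elim: s k F f g => [|v s IH] k F f g fg Cf sk Ux; first exact: fg.
case: k Cf sk => [_ /notF[]|k] /CkSP[df Cdf] sk.
apply: (congr1 (fun l : 'L(E, F) => l v)).
apply: (IH k _ (fderiv f) (fderiv g) _ Cdf sk Ux).
move=> z Uz; have fgz : \forall y \near z, f y = g y.
  by near=> y; apply: fg; near: y; exact: open_nbhs_nbhs.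
by have [_ ->] := eq_fderiv (df z Uz) fgz.
Unshelve. all: by end_near. Qed.

Lemma Ck_cst k F U (a : F) : open U -> Ck k U (cst a : E -> F).
Proof.
move=> oU; elim: k F a => [|k IH] F a; first by move=> x _; exact: cvg_cst.
by apply: (@CkS_is_diff _ _ _ _ _ _ (cst 0)) => // x _; exact: is_diff_cst.
Qed.

Lemma Ck_blin k F G U (L : 'L(F, G)) (g : E -> F) :
  open U -> Ck k U g -> Ck k U (fun z => L (g z)).
Proof.
move=> oU Cg.
exact: (Ck_bilinear oU (bounded_bilinear_eval _ _) (Ck_cst k L oU) Cg).
Qed.

(** A bounded linear map commutes with derivatives.  In the induction, [L] is
replaced by the post-composition with [L], which is again bounded and linear on
the space of derivatives. *)
Lemma Dn_blin k F G U (L : 'L(F, G)) (g : E -> F) (x : E) (s : seq E) :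
  open U -> Ck k U g -> (size s <= k)%N -> U x ->
  Dn (fun z => L (g z)) x s = L (Dn g x s).
Proof.
move=> oU; elim: s k F G L g => [|v s IH] [|k] F G L g Cg // sk Ux.
have /CkSP[dg Cdg] := Cg.
have bb := bounded_bilinear_eval F G.
pose post : 'L('L(E, F), 'L(E, G)) :=
  mkblin (comp_r (fun (l : 'L(F, G)) v => l v) L).
have postE : post = comp_r (fun (l : 'L(F, G)) v => l v) L :> (_ -> _).
  have [br _ [M _ bM]] := bounded_bilinear_comp_r E bb.
  exact: mkblinE (br L) (bM L).
have -> : L (Dn g x (v :: s)) = post (Dn (fderiv g) x s) v.
  by rewrite postE comp_rE.
rewrite -(IH k)//=; congr (blin_fun _ v).
apply/esym/(eq_Dn (k := k) (U := U)) => //; last exact: Ck_blin.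
move=> z Uz; apply: blin_ext => h.
have dLg : is_diff z (fun z => L (g z)) (fun h => L (fderiv g z h)).
  exact: is_diff_comp (is_diff_fderiv (dg z Uz)) (is_diff_blin L (g z)).
by rewrite (fderiv_val dLg) postE comp_rE.
Qed.

Lemma Ck_Dn k m F U (f : E -> F) (s : seq E) : open U ->
  Ck k U f -> (size s + m <= k)%N -> Ck m U (fun z => Dn f z s).
Proof.
move=> oU; elim: s k F f => [|v s IH] k F f Cf sk; first exact: Ck_le Cf.
case: k => [//|k] in Cf sk; have /CkSP[_ Cdf] := Cf.
have Cs := IH _ _ _ Cdf sk.
exact: (Ck_bilinear oU (bounded_bilinear_eval _ _) Cs (Ck_cst m v oU)).
Qed.

(** [Dn] peels derivatives off from the inside, the head of the list being the
direction of the innermost one.  Here the directions [s] are fixed first, and the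
resulting map is differentiated along [t]; evaluation at a fixed vector is bounded
and linear, hence commutes with these further derivatives. *)
Lemma Dn_cat k F U (f : E -> F) (x : E) (s t : seq E) : open U ->
  Ck k U f -> (size s + size t <= k)%N -> U x ->
  Dn f x (s ++ t) = Dn (fun z => Dn f z s) x t.
Proof.
move=> oU; elim: s k F f => [//|v s IH] k F f Cf sk Ux.
case: k => [//|k] in Cf sk; have /CkSP[_ Cdf] := Cf.
have Cs : Ck (size t) U (fun z => Dn (fderiv f) z s) by exact: Ck_Dn Cdf _.
pose ev : 'L('L(E, F), F) := mkblin (fun l : 'L(E, F) => l v).
have evE : ev = (fun l : 'L(E, F) => l v) :> (_ -> _).
  have [_ bl _] := bounded_bilinear_eval E F.
  by apply: (@mkblinE _ _ _ _ `|v|) => // l; rewrite mulrC ler_norm_blin.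
rewrite cat_cons /=.
rewrite (congr1 (fun l : 'L(E, F) => l v) (IH k _ (fderiv f) Cdf sk Ux)).
by have := Dn_blin ev oU Cs (leqnn _) Ux; rewrite evE => <-.
Qed.

Lemma Dn_rcons k F U (f : E -> F) (x v : E) (s : seq E) : open U ->
  Ck k U f -> (size s < k)%N -> U x ->
  Dn f x (rcons s v) = fderiv (fun z => Dn f z s) x v.
Proof.
by move=> oU Cf sk Ux; rewrite -cats1 (Dn_cat oU Cf)//= addn1.
Qed.

(** After the directions [s] are fixed, the two next directions are those of a
second derivative, which is symmetric on the whole of [U]; the derivatives along
[t] of the two sides are therefore the same. *)
Lemma Dn_swap k F U (f : E -> F) (x a b : E) (s t : seq E) : open U ->
  Ck k U f -> (size s + (size t).+2 <= k)%N -> U x ->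
  Dn f x (s ++ [:: a, b & t]) = Dn f x (s ++ [:: b, a & t]).
Proof.
move=> oU Cf sk Ux.
have sk' c d : (size (s ++ [:: c; d]) + size t <= k)%N.
  by rewrite size_cat /= -addnA.
have catE c d : s ++ [:: c, d & t] = (s ++ [:: c; d]) ++ t by rewrite -catA.
rewrite !catE !(Dn_cat oU Cf)//.
apply: (@eq_Dn (size t) _ U) => //; last exact: (Ck_Dn oU Cf).
move=> z Uz; have sk2 : (size s + 2 <= k)%N.
  by apply: leq_trans sk; rewrite leq_add2l.
rewrite !(Dn_cat oU Cf)//=.
have /CkSP[dg /CkSP[ddg _]] := Ck_Dn oU Cf sk2.
apply: fderiv2_sym; last exact: ddg.
by near=> y; apply: dg; near: y; exact: open_nbhs_nbhs.
Unshelve. all: by end_near. Qed.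

(** Adjacent transpositions generate all permutations: [bubble] carries an entry
to the right through [t1], and [main] matches the two lists entry by entry,
[p] being the prefix on which they already agree. *)
Lemma Dn_perm k F U (f : E -> F) (x : E) (s t : seq E) : open U ->
  Ck k U f -> (size s <= k)%N -> U x -> perm_eq s t -> Dn f x s = Dn f x t.
Proof.
move=> oU Cf sk Ux.
have bubble p a t1 t2 : (size (p ++ a :: t1 ++ t2) <= k)%N ->
    Dn f x (p ++ a :: t1 ++ t2) = Dn f x (p ++ t1 ++ a :: t2).
  elim: t1 p => [//|b t1 IH] p pk.
  rewrite cat_cons (Dn_swap _ _ oU Cf)//; last by rewrite size_cat in pk.
  rewrite -cat_rcons IH ?cat_rcons//.
  by apply: leq_trans pk; rewrite !(size_cat, size_rcons) /= !addnS.
have main p s' t' : (size (p ++ s') <= k)%N -> perm_eq s' t' ->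
    Dn f x (p ++ s') = Dn f x (p ++ t').
  elim: s' t' p => [|a s' IH] t' p pk.
    by rewrite perm_sym => /perm_nilP->.
  move=> st; have at' : a \in t' by rewrite -(perm_mem st) mem_head.
  case/splitPr: at' st => t1 t2.
  rewrite [perm_eq _ (t1 ++ _)]perm_sym -cat1s perm_catCA /= perm_cons perm_sym.
  move=> st; rewrite -bubble.
    rewrite -!cat_rcons; apply: IH => //.
    by rewrite cat_rcons.
  by move: pk; rewrite !size_cat /= (perm_size st) size_cat.
exact: (main [::]).
Qed.

End IteratedDerivatives.

(** * Differentiating one term of the formula *)

Lemma blin_sumE {R : realType} {E F : normedModType R} I (r : seq I) (P : pred I)
  (L : I -> 'L(E, F)) (y : E) :
  (\sum_(i <- r | P i) L i) y = \sum_(i <- r | P i) L i y.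
Proof. by apply: (big_morph (fun l : 'L(E, F) => l y)). Qed.

Section Leibniz.
Context {R : realType} {E F : normedModType R}.

Lemma is_diff_sum (x : E) I (r : seq I) (P : pred I) (f df : I -> E -> F) :
  (forall i, P i -> is_diff x (f i) (df i)) ->
  is_diff x (fun z => \sum_(i <- r | P i) f i z)
    (fun v => \sum_(i <- r | P i) df i v).
Proof.
move=> fdf; elim: r => [|i r IH].
  rewrite (_ : (fun z => _) = cst 0); last by apply: funext => z; rewrite big_nil.
  rewrite (_ : (fun v => _) = 0); last by apply: funext => z; rewrite big_nil.
  exact: is_diff_cst.
have consE (g : I -> E -> F) : (fun z => \sum_(j <- i :: r | P j) g j z) =
    (if P i then g i else cst 0) + (fun z => \sum_(j <- r | P j) g j z).
  by apply: funext => z; rewrite fctE big_cons; case: ifP; rewrite ?add0r.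
rewrite !consE; apply: is_diffD IH.
by case: ifP => [/fdf//|_]; exact: is_diff_cst.
Qed.

(** The product rule for a term of the formula, whose arguments [w b] and base
point [phi] all depend on the point.  By induction on [bs]: the first argument is
supplied last, so the term is the evaluation of
[Dn (fderiv psi) (phi z) [seq w b z | b <- bs]] at one more vector. *)
Lemma is_diff_Dn_comp k (G : normedModType R) (V : set F) (psi : F -> G)
  (phi : E -> F) (x : E) (I : eqType) (w : I -> E -> F) (bs : seq I) :
  Ck k V psi -> V (phi x) -> differentiable phi x ->
  (size bs < k)%N -> uniq bs -> {in bs, forall b, differentiable (w b) x} ->
  is_diff x (fun z => Dn psi (phi z) [seq w b z | b <- bs])
    (fun v => Dn psi (phi x) (rcons [seq w b x | b <- bs] (fderiv phi x v)) +
      \sum_(b <- bs) Dn psi (phi x)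
        [seq if c == b then fderiv (w c) x v else w c x | c <- bs]).
Proof.
move=> Cpsi Vx dphi; elim: bs k G psi Cpsi => [|b bs IH] [//|k] G psi /CkSP[dpsi Cdpsi].
  move=> _ _ _.
  have := is_diff_comp (is_diff_fderiv dphi) (is_diff_fderiv (dpsi _ Vx)).
  by congr is_diff_def; apply: funext => v; rewrite big_nil addr0.
rewrite ltnS => sk /= /andP[bbs ubs] dw.
have dwb : differentiable (w b) x by apply: dw; rewrite mem_head.
have dT := IH k _ (fderiv psi) Cdpsi sk ubs _.
have {}dT := dT (fun c cbs => dw c (mem_behead (s := b :: bs) cbs)).
have := is_diff_bilinear (bounded_bilinear_eval _ _) dT (is_diff_fderiv dwb).
congr is_diff_def; apply: funext => v.
rewrite big_cons eqxx addrC /= -addrA blin_sumE; congr (_ + _).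
rewrite addrC; congr (_ + _).
  congr (blin_fun (Dn _ _ _) _); apply/eq_in_map => c cbs.
  by rewrite (negbTE (memPn bbs c cbs)).
apply: eq_big_seq => c cbs.
by rewrite eq_sym (negbTE (memPn bbs c cbs)).
Qed.

End Leibniz.

(** * Partitions of a set with one more element *)

Section PartitionU1.
Import boot.finset.
Local Open Scope set_scope.

Context {T : finType}.
Implicit Types (P Q : {set {set T}}) (A B C : {set T}) (i : T).

Lemma setD1_notin (I : finType) (a : I) (S : {set I}) :
  a \notin S -> S :\ a = S.
Proof. by move=> aS; apply/setDidPl; rewrite disjoint_sym disjoints1. Qed.

(** The case [B = set0] stands for opening the new block {i}: [set0] is never a
block of [P], so nothing is removed.  Both ways of extending a partition are thus
covered by one formula. *)
Definition insert_in i P B : {set {set T}} := (i |: B) |: P :\ B.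

(** Removing [i] from its block leaves [set0] when that block was {i}; it is then
discarded. *)
Definition restrict_by i Q : {set {set T}} :=
  ((pblock Q i :\ i) |: Q :\ pblock Q i) :\ set0.

Lemma partition_insert_in i A P B : i \notin A -> partition P A ->
  B \in set0 |: P -> partition (insert_in i P B) (i |: A).
Proof.
move=> iA PA; have P0 := partition0 PA; rewrite !inE => /orP[/eqP->|BP].
  rewrite /insert_in setU0 (setD1_notin _) ?P0//.
  apply: partitionU1 => //; first by apply/set0Pn; exists i; rewrite set11.
  by rewrite disjoints1.
have BA := partitionS PA BP.
have -> : i |: A = (i |: B) :|: (A :\: B).
  apply/setP => x; rewrite !inE; case: (boolP (x \in B)) => [xB|_]; last by rewrite orbF.
  by rewrite (fintype.subsetP BA _ xB) !orbT.
rewrite /insert_in; apply: partitionU1; first exact: partitionD1.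
  by apply/set0Pn; exists i; rewrite setU11.
rewrite disjoints_subset subUset sub1set !inE negb_and iA orbT /=.
by apply/fintype.subsetP => x xB; rewrite !inE xB.
Qed.

Lemma pblock_insert_in i A P B : i \notin A -> partition P A ->
  B \in set0 |: P -> pblock (insert_in i P B) i = i |: B.
Proof.
move=> iA PA BP; have hP := partition_insert_in iA PA BP.
by apply: def_pblock; rewrite ?(partition_trivIset hP)// ?setU11.
Qed.

Lemma restrict_insert_in i A P B : i \notin A -> partition P A ->
  B \in set0 |: P -> restrict_by i (insert_in i P B) = P /\
    pblock (insert_in i P B) i :\ i = B.
Proof.
move=> iA PA BP; rewrite /restrict_by (pblock_insert_in iA PA BP).
have iP C : C \in set0 |: P -> i \notin C.
  rewrite !inE => /orP[/eqP->|CP]; first by rewrite inE.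
  by apply: contra iA; apply/fintype.subsetP; exact: partitionS PA CP.
have -> : (i |: B) :\ i = B by rewrite setU1K// iP.
split=> //; rewrite /insert_in setU1K; last first.
  rewrite !inE negb_and; apply/orP; right; apply/negP => iBP.
  by have := iP _ (setU1r _ iBP); rewrite setU11.
move: BP; rewrite inE => /orP[|BP].
  rewrite inE => /eqP->; rewrite setU1K ?inE ?eqxx//.
  by rewrite setD1_notin// (partition0 PA).
by rewrite setD1K// setD1_notin// (partition0 PA).
Qed.

Lemma partition_restrict_by i A Q : i \notin A -> partition Q (i |: A) ->
  [/\ partition (restrict_by i Q) A,
      pblock Q i :\ i \in set0 |: restrict_by i Q &
      insert_in i (restrict_by i Q) (pblock Q i :\ i) = Q].
Proof.
move=> iA QA; have Q0 := partition0 QA.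
rewrite /restrict_by; set C := pblock Q i; set B := C :\ i.
have iQ : i \in cover Q by rewrite (cover_partition QA) setU11.
have iC : i \in C by rewrite mem_pblock.
have CQ : C \in Q by rewrite pblock_mem.
have QCA := partitionD1 QA CQ.
have CA := partitionS QA CQ.
have BA : B \subset A.
  by apply/fintype.subsetP => x; rewrite !inE => /andP[xi /(fintype.subsetP CA)]; rewrite !inE (negbTE xi).
have BAE : A = B :|: ((i |: A) :\: C).
  apply/setP => x; rewrite !inE; case: (eqVneq x i) => [->|xi] /=.
    by rewrite iC (negbTE iA).
  case: (boolP (x \in C)) => //= xC.
  by have := fintype.subsetP CA _ xC; rewrite !inE (negbTE xi).
have BQ : B \notin Q :\ C.
  have [->|B0] := eqVneq B set0; first by rewrite !inE Q0 andbF.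
  rewrite !inE; apply/negP => /andP[BC BQ].
  have /trivIsetP/(_ _ _ BQ CQ BC) := partition_trivIset QA.
  rewrite disjoints_subset => BsC; case/set0Pn: B0 => x xB.
  have := fintype.subsetP BsC _ xB; rewrite inE => /negP; apply.
  by move: xB; rewrite inE => /andP[].
have RE : (B |: Q :\ C) :\ set0 = if B == set0 then Q :\ C else B |: Q :\ C.
  case: eqP => [B0|/eqP B0].
    by rewrite B0 setU1K// !inE Q0 andbF.
  by rewrite setD1_notin// !inE Q0 andbF orbF eq_sym.
split.
- rewrite RE; case: eqP => [B0|/eqP B0].
    by rewrite BAE B0 set0U.
  rewrite BAE; apply: partitionU1 => //.
  rewrite disjoints_subset; apply/fintype.subsetP => x; rewrite !inE.
  by case/andP=> _ ->.
- by rewrite RE; case: eqP => [->|_]; rewrite ?setU11// !inE eqxx orbT.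
- rewrite /insert_in setD1K// RE; case: eqP => [B0|_].
    by rewrite setD1_notin ?setD1K// -B0.
  by rewrite setU1K// setD1K.
Qed.

(** The pairs of a partition [P] of [A] and a choice of [B], either a block of [P]
or [set0], are in bijection with the partitions of [i |: A], by [insert_in] and
the inverse map that sends [Q] to [restrict_by i Q] and the block of [i] less
[i]. *)
Lemma big_partitionU1 (V : nmodType) (f : {set {set T}} -> V) i A :
  i \notin A ->
  (\sum_(Q | partition Q (i |: A)) f Q =
  \sum_(P | partition P A) (f ([set i] |: P) + \sum_(B in P) f (insert_in i P B)))%R.
Proof.
move=> iA; have sumU1 P : partition P A ->
    (f ([set i] |: P) + \sum_(B in P) f (insert_in i P B) =
     \sum_(B in set0 |: P) f (insert_in i P B))%R.
  move=> PA; rewrite big_setU1 ?(partition0 PA)//=.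
  by rewrite {2}/insert_in setU0 setD1_notin// (partition0 PA).
rewrite [RHS](eq_bigr _ sumU1).
rewrite pair_big_dep /=.
rewrite (reindex_onto (fun p => insert_in i p.1 p.2)
  (fun Q => (restrict_by i Q, pblock Q i :\ i))) /=; last first.
  by move=> Q /(partition_restrict_by iA)[].
apply: eq_bigl => -[P B] /=; apply/andP/andP => [[QA /eqP[PE BE]]|[PA BP]].
  have [] := partition_restrict_by iA QA.
  by rewrite PE BE.
split; first exact: partition_insert_in.
by have [-> ->] := restrict_insert_in iA PA BP.
Qed.

End PartitionU1.

(** * The formula *)

Section FaaDiBruno.
Context {R : realType}.

Lemma enum_setU1_last n (A : {set 'I_n}) (i : 'I_n) :
  (forall j, j \in A -> (j < i)%N) -> enum (i |: A)%SET = rcons (enum A) i.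
Proof.
move=> Ai; apply: (inj_map val_inj).
have enum_sorted (B : {set 'I_n}) : sorted ltn (map val (enum B)).
  rewrite sorted_map sorted_filter; first by [].
    by move=> a b c; exact: ltn_trans.
  by rewrite -sorted_map -enumT val_enum_ord iota_ltn_sorted.
apply: (irr_sorted_eq ltn_trans ltnn) => //.
  rewrite map_rcons (sorted_pairwise ltn_trans) pairwise_rcons.
  rewrite -(sorted_pairwise ltn_trans) enum_sorted andbT.
  by apply/allP => _ /mapP[j + ->]; rewrite mem_enum => /Ai.
apply: eq_mem_map => j.
by rewrite mem_rcons inE !mem_enum finset.in_setU1.
Qed.

Lemma perm_enum_setU1 (T : finType) (a : T) (S : {set T}) :
  a \notin S -> perm_eq (enum (a |: S)%SET) (a :: enum S).
Proof.
move=> aS; apply: uniq_perm; rewrite /= ?mem_enum ?aS ?enum_uniq//.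
by move=> b; rewrite inE !mem_enum finset.in_setU1.
Qed.

Lemma card_partition_le (T : finType) (P : {set {set T}}) (A : {set T}) :
  finset.partition P A -> (#|P| <= #|A|)%N.
Proof.
move=> PA; rewrite (card_partition PA) -sum1_card; apply: leq_sum => B BP.
by rewrite card_gt0 (partition_neq0 PA BP).
Qed.

Lemma Dblock_setU1 k (E F : normedModType R) (U : set E) (f : E -> F) (x : E) n
  (u : 'I_n -> E) (A : {set 'I_n}) (i : 'I_n) : open U -> Ck k U f -> U x ->
  (#|A| < k)%N -> (forall j, j \in A -> (j < i)%N) ->
  Dblock f x u (i |: A)%SET = fderiv (fun z => Dblock f z u A) x (u i).
Proof.
move=> oU Cf Ux Ak Ai; rewrite /Dblock enum_setU1_last// map_rcons.
by apply: (Dn_rcons _ oU Cf) => //; rewrite size_map -cardE.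
Qed.

Lemma differentiable_Dblock k (E F : normedModType R) (U : set E) (f : E -> F)
  (x : E) n (u : 'I_n -> E) (A : {set 'I_n}) : open U -> Ck k U f -> U x ->
  (#|A| < k)%N -> differentiable (fun z => Dblock f z u A) x.
Proof.
move=> oU Cf Ux Ak.
have Cs : Ck 1 U (fun z => Dblock f z u A).
  by apply: (Ck_Dn oU Cf); rewrite size_map -cardE addn1.
by have /CkSP[df _] := Cs; exact: df.
Qed.

(** The induction quantifies over the point [x], since it is the identity of two
functions on [U] that gets differentiated. *)
Lemma Dblock_comp k (E F G : normedModType R) (U : set E) (V : set F)
    (phi : E -> F) (psi : F -> G) (n : nat) (u : 'I_n -> E) (A : {set 'I_n}) (x : E) :
  open U -> open V -> (forall z, U z -> V (phi z)) ->
  Ck k U phi -> Ck k V psi -> (#|A| <= k)%N -> U x ->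
  Dblock (psi \o phi) x u A = \sum_(P : {set {set 'I_n}} | finset.partition P A)
    Dn psi (phi x) [seq Dblock phi x u B | B <- enum P].
Proof.
move=> oU oV UV Cphi Cpsi.
have Cc := Ck_comp oU UV Cphi Cpsi.
move: {2}#|A| (erefl #|A|) => m; elim: m A x => [|m IH] A x.
  move=> /eqP; rewrite cards_eq0 => /eqP-> _ _.
  rewrite (big_pred1 finset.set0) => [|P]; last by rewrite partition_set0.
  by rewrite /Dblock !enum_set0.
move=> Am Ak Ux.
have /card_gt0P[j0 j0A] : (0 < #|A|)%N by rewrite Am.
case: (arg_maxnP (fun i : 'I_n => val i) j0A) => i iA_ imax.
have {iA_} iA : i \in A by exact: iA_.
pose A' := (A :\ i)%SET.
have iA' : i \notin A' by rewrite !inE eqxx.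
have AE : A = (i |: A')%SET by rewrite finset.setD1K.
have A'm : #|A'| = m.
  by move: Am; rewrite (cardsD1 i) iA add1n => -[].
have mk : (m < k)%N by rewrite -Am.
have A'i j : j \in A' -> (j < i)%N.
  rewrite !inE => /andP[ji jA]; rewrite ltn_neqAle; apply/andP; split.
    by apply: contra ji => /eqP/val_inj->.
  exact: imax jA.
have dphi : differentiable phi x.
  by case: (k) Cphi mk => [//|k'] /CkSP[d _] _; exact: d.
rewrite AE (Dblock_setU1 _ oU Cc) ?A'm// big_partitionU1//.
have part_lt P B : finset.partition P A' -> B \in P -> (#|B| < k)%N.
  move=> PA BP; rewrite (leq_ltn_trans _ mk)// -A'm subset_leq_card//.
  exact: partitionS PA BP.
have PA'k P : finset.partition P A' -> (#|P| < k)%N.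
  by move=> /card_partition_le Pm; rewrite (leq_ltn_trans Pm)// A'm.
have dterm P : finset.partition P A' -> _ := fun PA =>
  @is_diff_Dn_comp R E F k G V psi phi x _ (fun B z => Dblock phi z u B) (enum P)
    Cpsi (UV _ Ux) dphi
    (leq_trans (eq_leq (congr1 succn (esym (cardE _)))) (PA'k P PA)) (enum_uniq _)
    (fun B BP => differentiable_Dblock u oU Cphi Ux
       (part_lt P B PA (etrans (esym (mem_enum _ _)) BP))).
have dsum := is_diff_sum (index_enum _) dterm.
have near_sum : \forall z \near x,
    \sum_(P : {set {set 'I_n}} | finset.partition P A')
      Dn psi (phi z) [seq Dblock phi z u B | B <- enum P] =
    Dblock (psi \o phi) z u A'.
  have : \forall z \near x, U z by exact: open_nbhs_nbhs.
  by apply: filterS => z Uz; apply/esym/IH => //; rewrite A'm ltnW.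
have [_ dE] := eq_fderiv (ex_diff (is_diff_def := dsum)) near_sum.
rewrite (congr1 (fun l : 'L(E, G) => l (u i)) dE).
rewrite (congr1 (fun l => l (u i)) (fderiv_val dsum)).
apply: eq_bigr => P PA.
have iP B : B \in P -> i \notin B.
  by move=> BP; apply: contra iA'; apply/fintype.subsetP; exact: partitionS PA BP.
pose D B := Dblock phi x u B.
(* [psi] is differentiated: a block {i} is added *)
congr (_ + _).
  have -> : fderiv phi x (u i) = D [set i]%SET by rewrite /D /Dblock enum_set1.
  rewrite -map_rcons; apply: (Dn_perm oV Cpsi) (UV _ Ux) _.
    by rewrite size_map size_rcons -cardE PA'k.
  rewrite perm_sym; apply: perm_map.
  apply: (perm_trans (perm_enum_setU1 _)); last by rewrite perm_sym perm_rcons.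
  by apply/negP => /iP; rewrite set11.
(* the factor of the block [B] is differentiated: [i] joins [B] *)
rewrite -[RHS]big_enum /=.
apply: eq_big_seq => B; rewrite mem_enum => BP.
pose g C := if C == B then fderiv (fun z => Dblock phi z u C) x (u i) else D C.
apply: (Dn_perm oV Cpsi) (UV _ Ux) _.
  rewrite size_map -cardE; exact: ltnW (PA'k P PA).
have permP : perm_eq (enum P) (B :: enum (P :\ B)%SET).
  rewrite -{1}(finset.setD1K BP); apply: perm_enum_setU1.
  by rewrite finset.setD11.
have permP' : perm_eq (enum (insert_in i P B)) ((i |: B)%SET :: enum (P :\ B)%SET).
  apply: perm_enum_setU1; apply/negP; rewrite finset.in_setD1 => /andP[_ /iP].
  by rewrite setU11.
apply: (perm_trans (perm_map g permP)).
rewrite perm_sym; apply: (perm_trans (perm_map D permP')).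
have -> : map g (B :: enum (P :\ B)%SET) = map D ((i |: B)%SET :: enum (P :\ B)%SET).
  rewrite /=; congr (_ :: _).
    rewrite /g eqxx; apply/esym/(Dblock_setU1 _ oU Cphi Ux).
      exact: part_lt PA BP.
    by move=> j jB; apply: A'i; exact: (fintype.subsetP (partitionS PA BP)).
  by apply/eq_in_map => C; rewrite mem_enum finset.in_setD1 /g => /andP[/negbTE->].
exact: perm_refl.
Qed.

End FaaDiBruno.

Theorem theorem16 (R : realType) (E F G : completeNormedModType R)
    (UE : set E) (UF : set F) (hUE : open UE) (hUF : open UF)
    (k : nat) (hk : (1 <= k)%N)
    (phi : E -> F) (psi : F -> G) (hphi : Ck k UE phi) (hpsi : Ck k UF psi)
    (x : E) (hx : UE x) (hy : UF (phi x)) :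
  Ck k (UE `&` phi @^-1` UF) (psi \o phi) /\
  forall u : 'I_k -> E,
    Dn (psi \o phi) x [seq u i | i <- enum 'I_k] =
    \sum_(P : {set {set 'I_k}} | finset.partition P [set: 'I_k]%SET)
      Dn psi (phi x) [seq Dblock phi x u B | B <- enum P].
Proof.
set W := UE `&` phi @^-1` UF.
have oW : open W.
  rewrite openE => z [UEz UFz]; apply: filterI; first exact: open_nbhs_nbhs.
  by apply: (Ck_continuous hphi UEz); exact: open_nbhs_nbhs.
have phiW : forall z, W z -> UF (phi z) by move=> z [].
have Cphi : Ck k W phi by apply: CkW hphi => z [].
split; first exact: Ck_comp oW phiW Cphi hpsi.
move=> u; have := @Dblock_comp R k E F G W UF phi psi k u [set: 'I_k]%SET x
  oW hUF phiW Cphi hpsi.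
by rewrite cardsT card_ord /Dblock enum_setT -enumT; apply.
Qed.
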